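(* The following are equivalent for a commutative Noetherian ring $R$: (1) $R$ is Artinian; (2) $R$ is semilocal (i.e. $R/J(R)$ is semisimple) and $J(R)$ is nilpotent; (3) $R$ is an FMax-ring and $J(R)$ is nilpotent; (4) $R$ is an FMax-ring and $J(R)$ is a nil ideal; (5) $K.\dim(R)=0$; (6) $\mathrm{Spec}(R)$ is finite and $T_1$ (respectively: finite and $R_0$; finite and $R_1$; finite and $T_2$; each variant being one of the equivalent conditions); (7) $\mathrm{Spec}(R)$ is discrete (respectively: discrete and finite); (8) $R$ is a PAMin-ring; (9) $R$ is a PBMax-ring; (10) $R$ is $\pi$-regular.
   Context: Rings are unital with $1\ne 0$. $J(R)$ (the Jacobson radical) is the intersection of all maximal ideals. $\mathrm{Spec}(R)$ carries the Zariski topology and $K.\dim(R)$ is the Krull dimension. $R$ is an FMax-ring iff it has only finitely many maximal ideals. A minimal prime is absolutely minimal iff it does not contain the intersection of all the other minimal primes; a maximal ideal is barely maximal iff it does not contain the intersection of all the other maximal ideals (the empty intersection being $R$). $R$ is a PAMin-ring iff every prime ideal is an absolutely minimal (minimal) prime; a PBMax-ring iff every prime ideal is a barely maximal (maximal) ideal. $R$ is $\pi$-regular iff for every $a\in R$ there are $b\in R$ and $n\ge1$ with $a^n=a^nba^n$. Two points of a space are topologically distinguishable iff some open set contains exactly one of them. A space is $R_0$ iff for any two topologically distinguishable points $x,y$ there are open $U_x\ni x$, $U_y\ni y$ with $y\notin U_x$, $x\notin U_y$; it is $R_1$ iff any two topologically distinguishable points have disjoint open neighborhoods. *)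

(* Defs.v *)
From HB Require Import structures.
From mathcomp Require Import all_boot all_order all_algebra.
From mathcomp Require Import boolp classical_sets cardinality constructive_ereal.
From mathcomp Require Import topology_structure separation_axioms.

Set Implicit Arguments.
Unset Strict Implicit.
Unset Printing Implicit Defensive.

Import GRing.Theory.
Local Open Scope classical_set_scope.
Local Open Scope ring_scope.

(* Subsets of a ring are [Prop]-valued sets [I : set R]; [[in I]] is the
   boolean predicate that the closure conditions of the library expect. *)

Section Ideals.
Variable R : comNzRingType.
Implicit Types I J M P : set R.

(* The ideals of R, including R itself, are the submodules of R^o. *)
Definition ideal I : Prop := submod_closed ([in I] : {pred R^o}).

(* In the library, [idealr_closed] requires 1 to lie outside of the ideal. *)
Definition proper_ideal I : Prop := idealr_closed [in I].

Definition prime_ideal P : Prop :=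
  proper_ideal P /\ prime_idealr_closed [in P].

Definition maximal_ideal M : Prop :=
  proper_ideal M /\ forall I, proper_ideal I -> M `<=` I -> I = M.

Definition minimal_prime P : Prop :=
  prime_ideal P /\ forall Q, prime_ideal Q -> Q `<=` P -> Q = P.

Definition jacobson : set R := \bigcap_(M in maximal_ideal) M.

Definition ideal_generated (A : set R) : set R :=
  \bigcap_(I in [set I | ideal I /\ A `<=` I]) I.

Definition ideal_mul I J : set R :=
  ideal_generated [set x * y | x in I & y in J].

Definition ideal_exp I (n : nat) : set R := iter n (ideal_mul I) setT.

Definition nilpotent_ideal I : Prop := exists n, ideal_exp I n = [set 0].

Definition nil_ideal I : Prop := forall x, I x -> exists n, x ^+ n = 0.

Lemma idealE I : ideal I <->
  I 0 /\ forall a x y, I x -> I y -> I (a * x + y).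
Proof.
have memE x : (x \in ([in I] : {pred R^o})) = (x \in I) by [].
split=> [[I0 Ilin]|[I0 Ilin]]; split.
- by apply: set_mem; rewrite -memE.
- move=> a x y Ix Iy; apply: set_mem; rewrite -memE.
  by apply: Ilin; rewrite memE; exact: mem_set.
- by rewrite memE; exact: mem_set.
- move=> a x y; rewrite !memE => /set_mem Ix /set_mem Iy.
  by apply: mem_set; exact: Ilin.
Qed.

Lemma proper_idealE I : proper_ideal I <-> ideal I /\ ~ I 1.
Proof.
have memE x : (x \in [in I]) = (x \in I) by [].
split=> [[I0 I1 Ilin]|[[I0 Ilin] I1]].
  by split=> // I1'; move: I1; rewrite memE (mem_set I1').
by split=> //; apply/negP; rewrite memE => /set_mem.
Qed.

Lemma ideal_set0 : ideal [set 0].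
Proof.
by apply/idealE; split=> // a x y /= -> ->; rewrite mulr0 addr0.
Qed.

Lemma exists_maximal_ideal : exists M, maximal_ideal M.
Proof.
pose P I := I = set0 \/ proper_ideal I.
have [F PF Ftot|M [PM Mmax]] := @Zorn_bigcup R P.
  have [[X [FX [z Xz]]]|F0] := pselect (exists X, F X /\ X !=set0); last first.
    left; apply/seteqP; split=> // x [X FX Xx].
    by case: F0; exists X; split=> //; exists x.
  have proper A x : F A -> A x -> proper_ideal A.
    by move=> FA Ax; case: (PF _ FA) => // A0; move: Ax; rewrite A0.
  right; apply/proper_idealE; split; last first.
    by case=> A FA A1; have /proper_idealE[_] := proper _ _ FA A1; exact.
  apply/idealE; split.
    have /proper_idealE[/idealE[X0 _] _] := proper _ _ FX Xz.
    by exists X.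
  move=> a x y [A FA Ax] [B FB By].
  have closed C : F C -> C x -> C y ->
      (\bigcup_(D in F) D) (a * x + y).
    move=> FC Cx Cy; exists C => //.
    have /proper_idealE[/idealE[_ Clin] _] := proper _ _ FC Cx.
    exact: Clin.
  have [AB|BA] := Ftot _ _ FA FB.
    by apply: (closed B) => //; exact: AB.
  by apply: (closed A) => //; exact: BA.
have proper0 : proper_ideal [set 0].
  apply/proper_idealE; split; first exact: ideal_set0.
  by move=> /= /eqP; rewrite oner_eq0.
have properM : proper_ideal M.
  case: PM => // M0; exfalso; apply: (Mmax [set 0]); last by right.
  by rewrite M0; split=> // /(_ 0 erefl).
exists M; split=> // I properI MI; apply/seteqP; split=> //.
by apply: contrapT => IM; apply: (Mmax I); [split | right].
Qed.

Lemma jacobson_proper : proper_ideal jacobson.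
Proof.
have [M Mmax] := exists_maximal_ideal.
apply/proper_idealE; split.
  apply/idealE; split=> [N [/proper_idealE[/idealE[]]]//|a x y Jx Jy N Nmax].
  have [/proper_idealE[/idealE[_ Nlin] _] _] := Nmax.
  by apply: Nlin; [exact: Jx | exact: Jy].
by move=> J1; have [/proper_idealE[_ M1] _] := Mmax; apply: M1; exact: J1.
Qed.

(* Boolean form of the Jacobson radical, so that the ring R / J(R) is
   [{ideal_quot jacobson_pred R}]. *)
Definition jacobson_pred : {pred R} := [in jacobson].

HB.instance Definition _ := isIdealr.Build R jacobson_pred jacobson_proper.

End Ideals.

Arguments jacobson R : clear implicits.
Arguments jacobson_pred R : clear implicits.

Section RingClasses.
Variable R : comNzRingType.
Implicit Types I S M P : set R.

Definition noetherian : Prop :=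
  forall I : nat -> set R, (forall n, ideal (I n)) ->
    (forall n, I n `<=` I n.+1) ->
    exists N, forall n, (N <= n)%N -> I n = I N.

Definition artinian : Prop :=
  forall I : nat -> set R, (forall n, ideal (I n)) ->
    (forall n, I n.+1 `<=` I n) ->
    exists N, forall n, (N <= n)%N -> I n = I N.

(* Simple submodules of R^o *)
Definition simple_ideal S : Prop :=
  [/\ ideal S, S <> [set 0] &
      forall I, ideal I -> I `<=` S -> I = [set 0] \/ I = S].

(* R^o is the internal direct sum of a set F of simple submodules; the sum of
   a family of submodules is the submodule generated by its union. *)
Definition semisimple_ring : Prop :=
  exists F : set (set R),
    [/\ F `<=` simple_ideal,
        ideal_generated (\bigcup_(S in F) S) = [set: R] &
        forall S, F S ->
          S `&` ideal_generated (\bigcup_(T in F `\ S) T) = [set 0]].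

Definition fmax_ring : Prop := finite_set (@maximal_ideal R).

Definition absolutely_minimal P : Prop :=
  minimal_prime P /\
  ~ (\bigcap_(Q in @minimal_prime R `\ P) Q `<=` P).

Definition barely_maximal M : Prop :=
  maximal_ideal M /\
  ~ (\bigcap_(N in @maximal_ideal R `\ M) N `<=` M).

Definition pamin_ring : Prop := forall P, prime_ideal P -> absolutely_minimal P.

Definition pbmax_ring : Prop := forall P, prime_ideal P -> barely_maximal P.

Definition pi_regular : Prop :=
  forall a : R, exists b n, (1 <= n)%N /\ a ^+ n = a ^+ n * b * a ^+ n.

(* The strict chain C 0 `<` ... `<` C n of prime ideals has length n. *)
Definition prime_chain (n : nat) (C : nat -> set R) : Prop :=
  (forall i, (i <= n)%N -> prime_ideal (C i)) /\
  (forall i, (i < n)%N -> C i `<` C i.+1).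

(* The default value -oo of [supremum] is not used: R is nontrivial, so there
   is always a chain of length 0. *)
Definition krull_dim : \bar int :=
  supremum -oo%E
    [set n%:Z%:E | n in [set n | exists C : nat -> set R, prime_chain n C]].

End RingClasses.

Arguments noetherian R : clear implicits.
Arguments artinian R : clear implicits.
Arguments semisimple_ring R : clear implicits.
Arguments fmax_ring R : clear implicits.
Arguments pamin_ring R : clear implicits.
Arguments pbmax_ring R : clear implicits.
Arguments pi_regular R : clear implicits.
Arguments krull_dim R : clear implicits.

Definition semilocal (R : comNzRingType) : Prop :=
  semisimple_ring {ideal_quot jacobson_pred R}.

Definition Spec (R : comNzRingType) : Type :=
  set_type [set P : set R | prime_ideal P].

HB.instance Definition _ (R : comNzRingType) := Choice.on (Spec R).

Section Zariski.
Variable R : comNzRingType.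

Definition zero_locus (E : set R) : set (Spec R) :=
  [set P | E `<=` val P].

Definition zariski_open : set (set (Spec R)) :=
  [set ~` zero_locus E | E in [set: set R]].

Lemma Spec_prime (P : Spec R) : prime_ideal (val P).
Proof. exact: set_mem (valP P). Qed.

Lemma zariski_openT : zariski_open setT.
Proof.
exists setT => //; apply/seteqP; split=> // P _ /(_ 1 I).
by have [/proper_idealE[]] := Spec_prime P.
Qed.

Lemma zariski_openI : setI_closed zariski_open.
Proof.
move=> _ _ [E _ <-] [F _ <-].
exists [set x * y | x in E & y in F] => //.
apply/seteqP; split=> P; have [Pp Pprime] := Spec_prime P.
  have /proper_idealE[/idealE[P0 Plin] _] := Pp.
  have Pmul a x : val P x -> val P (a * x).
    by move=> Px; have := Plin a x 0 Px P0; rewrite addr0.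
  move=> EFP; split=> VP; apply: EFP => _ [x Ex [y Fy <-]].
    by rewrite mulrC; apply: Pmul; exact: VP.
  by apply: Pmul; exact: VP.
move=> [nE nF] EFP; apply: nE => x Ex; apply: contrapT => nPx.
have memE z : (z \in [in val P]) = (z \in val P) by [].
apply: nF => y Fy; have := Pprime x y; rewrite !memE => Pxy.
have /Pxy/orP[/set_mem //|/set_mem //] : x * y \in val P.
by apply: mem_set; apply: EFP; exists x => //; exists y.
Qed.

Lemma zariski_open_bigU (T : Type) (f : T -> set (Spec R)) :
  (forall i, zariski_open (f i)) -> zariski_open (\bigcup_i f i).
Proof.
move=> fopen.
exists [set x | exists i E, f i = ~` zero_locus E /\ E x] => //.
apply/seteqP; split=> P.
  move=> nV; apply: contrapT => nf; apply: nV => x [i [E [fE Ex]]].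
  apply: contrapT => nPx; apply: nf; exists i => //; rewrite fE => VP.
  by apply: nPx; exact: VP.
move=> [i _ fiP] VP; have [E _ fE] := fopen i; move: fiP; rewrite -fE; apply.
by move=> x Ex; apply: VP; exists i, E.
Qed.

HB.instance Definition _ := isOpenTopological.Build (Spec R)
  zariski_openT zariski_openI zariski_open_bigU.

Lemma open_SpecE : (open : set (set (Spec R))) = zariski_open.
Proof. by []. Qed.

End Zariski.

Section Topology.
Variable T : topologicalType.

Definition distinguishable (x y : T) : Prop :=
  exists U : set T, open U /\ ((U x /\ ~ U y) \/ (U y /\ ~ U x)).

Definition R0_space : Prop := forall x y : T, distinguishable x y ->
  exists U V : set T, [/\ open U /\ U x, open V /\ V y, ~ U y & ~ V x].

Definition R1_space : Prop := forall x y : T, distinguishable x y ->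
  exists U V : set T, [/\ open U /\ U x, open V /\ V y & U `&` V = set0].

Definition discrete_space : Prop := forall A : set T, open A.

End Topology.

Arguments R0_space T : clear implicits.
Arguments R1_space T : clear implicits.
Arguments discrete_space T : clear implicits.

(* Main.v *)
(* Every condition is equivalent to: each prime ideal is maximal.  If I is not
   prime, then a * b lies in I for some a and b outside of I, so I + (a) and
   (I : a) are strictly larger than I, and noetherian induction reduces a
   property of R / I to the case of a prime ideal I.  When the primes are
   maximal, this gives three facts: the descending chain condition (ideals J in
   K with J + (a) = K + (a) and (J : a) = (K : a) are equal), the finiteness of
   the set of primes, and the nilpotency of J(R).  Since a prime that contains a
   finite intersection of ideals contains one of them, finiteness makes every
   point of Spec(R) isolated and every maximal ideal barely maximal; then
   R / J(R) is the direct sum of the intersections of all its maximal ideals but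
   one. *)
Require Import Defs.
From mathcomp Require Import all_boot all_order all_algebra.
From mathcomp Require Import boolp classical_sets cardinality constructive_ereal.
From mathcomp Require Import topology_structure separation_axioms.
Local Open Scope classical_set_scope.
Local Open Scope ring_scope.

Import GRing.Theory.

(** * Ideals, primes and maximal ideals in elementwise form *)

Definition colon {R : comNzRingType} (I : set R) (a : R) : set R :=
  [set x | I (a * x)].

Definition add_principal {R : comNzRingType} (I : set R) (a : R) : set R :=
  [set x | exists r, I (x - r * a)].

Definition primes_maximal (R : comNzRingType) : Prop :=
  forall P : set R, prime_ideal P -> maximal_ideal P.

Section IdealTheory.
Context {R : comNzRingType}.
Implicit Types (I J K M P : set R) (a x y : R).

Lemma ideal0 {I} : ideal I -> I 0.
Proof. by move/idealE => []. Qed.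

Lemma idealMl {I} a {x} : ideal I -> I x -> I (a * x).
Proof.
by move=> idI Ix; move/idealE: (idI) => [I0 /(_ a x 0 Ix I0)]; rewrite addr0.
Qed.

Lemma idealD {I x y} : ideal I -> I x -> I y -> I (x + y).
Proof.
by move=> /idealE[_ Ilin] Ix Iy; have := Ilin 1 _ _ Ix Iy; rewrite mul1r.
Qed.

Lemma idealB {I x y} : ideal I -> I x -> I y -> I (x - y).
Proof.
by move=> idI Ix Iy; rewrite -mulN1r; apply: idealD => //; exact: idealMl.
Qed.

Lemma idealT : ideal [set: R].
Proof. exact/idealE. Qed.

Lemma ideal_bigcap (F : set (set R)) :
  F `<=` @ideal R -> ideal (\bigcap_(I in F) I).
Proof.
move=> idF; apply/idealE; split=> [I FI|a x y Fx Fy I FI].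
  exact: ideal0 (idF _ FI).
apply: (idealD (idF _ FI)); last exact: Fy.
by apply: idealMl; [exact: idF|exact: Fx].
Qed.

Lemma ideal_eqT {I} : ideal I -> I 1 -> I = setT.
Proof.
move=> idI I1; apply/seteqP; split=> // x _.
by rewrite -(mulr1 x); exact: idealMl.
Qed.

Lemma ideal_colon {I} a : ideal I -> ideal (colon I a).
Proof.
move=> idI; apply/idealE; rewrite /colon /=; split.
  by rewrite mulr0; exact: ideal0.
move=> b x y Ix Iy; rewrite mulrDr mulrCA.
by apply: idealD => //; exact: idealMl.
Qed.

Lemma sub_colon {I} a : ideal I -> I `<=` colon I a.
Proof. by move=> idI x Ix; exact: idealMl. Qed.

Lemma ideal_add_principal {I} a : ideal I -> ideal (add_principal I a).
Proof.
move=> idI; apply/idealE; split.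
  by exists 0; rewrite mul0r subr0; exact: ideal0.
move=> b x y [r Ix] [s Iy]; exists (b * r + s).
rewrite mulrDl opprD addrACA -mulrA -mulrBr.
by apply: idealD => //; exact: idealMl.
Qed.

Lemma sub_add_principal I a : I `<=` add_principal I a.
Proof. by move=> x Ix; exists 0; rewrite mul0r subr0. Qed.

Lemma add_principal_mem {I} a : ideal I -> add_principal I a a.
Proof. by move=> idI; exists 1; rewrite mul1r subrr; exact: ideal0. Qed.

Lemma add_principal_sub {I K} {a} : ideal K -> I `<=` K -> K a ->
  add_principal I a `<=` K.
Proof.
move=> idK IK Ka x [r Ixra]; rewrite -(subrK (r * a) x).
by apply: idealD; [|exact: IK|exact: idealMl].
Qed.

Lemma prime_idealP P : prime_ideal P <->
  [/\ ideal P, ~ P 1 & forall x y, P (x * y) -> P x \/ P y].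
Proof.
have memE x : (x \in [in P]) = (x \in P) by [].
split=> [[/proper_idealE[idP P1] Pmul]|[idP P1 Pmul]].
  split=> // x y Pxy; have := Pmul x y; rewrite !memE.
  by move=> /(_ (mem_set Pxy))/orP[/set_mem|/set_mem]; [left|right].
split; first exact/proper_idealE.
move=> x y; rewrite !memE => /set_mem/Pmul[Px|Py]; apply/orP; [left|right];
  exact: mem_set.
Qed.

Lemma prime_ideal_ideal {P} : prime_ideal P -> ideal P.
Proof. by move=> /prime_idealP[]. Qed.

Lemma prime_ideal1 {P} : prime_ideal P -> ~ P 1.
Proof. by move=> /prime_idealP[]. Qed.

Lemma prime_idealM {P x y} : prime_ideal P -> P (x * y) -> P x \/ P y.
Proof. by move=> /prime_idealP[_ _]; apply. Qed.

Lemma prime_idealX {P x} n : prime_ideal P -> P (x ^+ n) -> P x.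
Proof.
move=> prP; elim: n => [/(prime_ideal1 prP)//|n IHn].
by rewrite exprS => /(prime_idealM prP)[].
Qed.

(** R / M is a field, expressed without the quotient: [r] inverts [x] modulo [M]. For [x] outside a
    maximal [M], the ideal M + (x) differs from [M], so it contains 1. *)
Lemma maximal_idealP M : maximal_ideal M <->
  [/\ ideal M, ~ M 1 & forall x, ~ M x -> exists r, M (1 - r * x)].
Proof.
split=> [[/proper_idealE[idM M1] Mmax]|[idM M1 Minv]].
  split=> // x nMx; apply: contrapT => nex; apply: nMx.
  rewrite -(Mmax (add_principal M x)); first exact: add_principal_mem.
    by apply/proper_idealE; split=> //; exact: ideal_add_principal.
  exact: sub_add_principal.
split; first exact/proper_idealE.
move=> I /proper_idealE[idI I1] MI; apply/seteqP; split=> // x Ix.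
apply: contrapT => /Minv[r Mrx]; apply: I1.
by rewrite -(subrK (r * x) 1); apply: idealD; [|exact: MI|exact: idealMl].
Qed.

Lemma maximal_prime {M} : maximal_ideal M -> prime_ideal M.
Proof.
move=> /maximal_idealP[idM M1 Minv]; apply/prime_idealP; split=> // x y Mxy.
have [Mx|/Minv[r Mrx]] := pselect (M x); [by left|right].
(* [y = (1 - r * x) * y + r * (x * y)], and both terms lie in [M]. *)
rewrite -(mul1r y) -(subrK (r * x) 1) mulrDl -mulrA.
by apply: idealD; [|rewrite mulrC|]; try exact: idealMl.
Qed.

Lemma maximal_sub_prime {M P} :
  maximal_ideal M -> prime_ideal P -> M `<=` P -> P = M.
Proof. by move=> [_ Mmax] [properP _] MP; exact: Mmax. Qed.

(** If no ideal of [F] lies in [P], pick in each an element outside [P]; the product of these is in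
    every member of [F] but not in the prime [P]. The empty product 1 starts the induction. *)
Lemma prime_bigcap_sub {F : set (set R)} {P} :
  finite_set F -> F `<=` @ideal R -> prime_ideal P ->
  \bigcap_(I in F) I `<=` P -> exists2 I, F I & I `<=` P.
Proof.
move=> /finite_seqP[s Fs] idF prP capP; apply: contrapT => nFP.
suff [x nPx xs] : exists2 x, ~ P x & forall I, I \in s -> I x.
  by apply: nPx; apply: capP => I; rewrite Fs => /xs.
have {capP nFP Fs}idnP I : I \in s -> ideal I /\ ~ I `<=` P.
  move=> Is; have FI : F I by rewrite Fs.
  by split; [exact: idF|move=> IP; apply: nFP; exists I].
elim: s idnP => [|I s IHs] idnP.
  by exists 1 => //; exact: prime_ideal1.
have [J Js|x nPx xs] := IHs; first by apply: idnP; rewrite inE Js orbT.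
have [idI /existsNP[y /not_implyP[Iy nPy]]] := idnP I (mem_head _ _).
exists (x * y); first by move=> /(prime_idealM prP)[].
move=> J; rewrite inE => /orP[/eqP->|Js]; first exact: idealMl.
rewrite mulrC; apply: idealMl (xs _ Js).
by apply: (idnP _ _).1; rewrite inE Js orbT.
Qed.

Lemma ideal_ideal_generated (A : set R) : ideal (ideal_generated A).
Proof. by apply: ideal_bigcap => I []. Qed.

Lemma sub_ideal_generated (A : set R) : A `<=` ideal_generated A.
Proof. by move=> x Ax I [_]; exact. Qed.

Lemma ideal_generated_sub {A : set R} {K} :
  ideal K -> A `<=` K -> ideal_generated A `<=` K.
Proof. by move=> idK AK x; apply. Qed.

Lemma ideal_ideal_exp J n : ideal (ideal_exp J n).
Proof. by case: n => [|n]; [exact: idealT|exact: ideal_ideal_generated]. Qed.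

Lemma ideal_expS_mem {J n x y} : J x -> ideal_exp J n y ->
  ideal_exp J n.+1 (x * y).
Proof.
by move=> Jx Jny; apply: sub_ideal_generated; exists x => //; exists y.
Qed.

Lemma ideal_expS_sub {J n K} : ideal K ->
  (forall x, J x -> ideal_exp J n `<=` colon K x) -> ideal_exp J n.+1 `<=` K.
Proof.
move=> idK JK; apply: ideal_generated_sub => //.
by move=> _ [x Jx [y Jny <-]]; exact: (JK x).
Qed.

Lemma ideal_expX {J n x} : J x -> ideal_exp J n (x ^+ n).
Proof.
by move=> Jx; elim: n => // n IHn; rewrite exprS; exact: ideal_expS_mem.
Qed.

(** The inclusion of J^(m+n) in J^m J^n, tested against an arbitrary ideal [K]. Induction on [m]
    peels off a factor [x] in [J] and replaces [K] with (K : x). *)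
Lemma ideal_expD_sub {J m n K} : ideal K ->
  (forall x y, ideal_exp J m x -> ideal_exp J n y -> K (x * y)) ->
  ideal_exp J (m + n) `<=` K.
Proof.
elim: m K => [|m IHm] K idK mulK.
  by move=> y Jny; rewrite -(mul1r y); exact: mulK.
apply: ideal_expS_sub => // x Jx; apply: IHm; first exact: ideal_colon.
move=> z y Jmz Jny; rewrite /colon /= mulrA.
by apply: mulK => //; exact: ideal_expS_mem.
Qed.

Lemma nilpotent_nil {J} : nilpotent_ideal J -> nil_ideal J.
Proof.
by move=> [n Jn0] x Jx; exists n; have := @ideal_expX J n x Jx; rewrite Jn0.
Qed.

Lemma primes_maximalP : (forall P x, prime_ideal P -> ~ P x ->
  exists r, P (1 - r * x)) -> primes_maximal R.
Proof.
by move=> inv P prP; have [idP P1 _] := (prime_idealP P).1 prP;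
  apply/maximal_idealP; split=> // x; exact: inv.
Qed.

Lemma pi_regular_primes_maximal : pi_regular R -> primes_maximal R.
Proof.
move=> piR; apply: primes_maximalP => P x prP nPx.
(* [x ^+ n * (1 - b * x ^+ n)] vanishes and [x ^+ n] is outside [P], so [b * x ^+ n] is 1 modulo
   [P]; as [n] is positive, one factor [x] splits off. *)
have [b [n [n1 xn]]] := piR x; exists (b * x ^+ n.-1).
have idP := prime_ideal_ideal prP.
rewrite -mulrA -exprSr prednK //.
have /(prime_idealM prP)[/(prime_idealX _ prP)//|//] :
  P (x ^+ n * (1 - b * x ^+ n)).
by rewrite mulrBr mulr1 mulrA -xn subrr; exact: ideal0.
Qed.

Lemma artinian_pi_regular : artinian R -> pi_regular R.
Proof.
move=> artR a.
have [n|n x [r ->]|N Nst] := artR (fun n => [set x | exists r, x = r * a ^+ n]).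
- apply/idealE; split; first by exists 0; rewrite mul0r.
  by move=> b x y [r ->] [s ->]; exists (b * r + s); rewrite mulrDl mulrA.
- by exists (r * a); rewrite exprS mulrA.
(* The ideals (a^n) are constant from [N] on. The exponent [N.+1] is positive, as pi-regularity
   demands. *)
have [r ar] : exists r, a ^+ N.+1 = r * a ^+ (N.+1 + N.+1).
  have : [set x | exists r, x = r * a ^+ N.+1] (a ^+ N.+1).
    by exists 1; rewrite mul1r.
  rewrite Nst // -(Nst (N.+1 + N.+1)%N) //.
  exact: leq_trans (leqnSn N) (leq_addr _ _).
by exists r, N.+1; split=> //; rewrite {1}ar exprD mulrCA mulrA.
Qed.

End IdealTheory.

(** * Noetherian induction and conditions that force primes to be maximal *)

Section Noetherian.
Context {R : comNzRingType} (noethR : noetherian R).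
Implicit Types (I J K M P : set R) (a x y : R).

(** If [Q] fails at an ideal, [step] forces a failure at a strictly larger one; repeated choice of
    such ideals gives a chain that never stabilizes. *)
Lemma noetherian_ind (Q : set R -> Prop) :
  (forall I, ideal I ->
    (forall J, ideal J -> I `<` J -> Q J) -> Q I) ->
  forall I, ideal I -> Q I.
Proof.
move=> step I0 idI0; apply: contrapT => nQI0.
pose T := {I | ideal I /\ ~ Q I}.
have grow (I : T) : exists J : T, sval I `<` sval J.
  case: I => I [idI nQI]; apply: contrapT => nJ; apply: (nQI).
  apply: (step _ idI) => J idJ IJ; apply: contrapT => nQJ.
  by apply: nJ; exists (exist _ J (conj idJ nQJ)); exact: IJ.
have [f fP] := choice grow.
pose c n := iter n f (exist _ I0 (conj idI0 nQI0) : T).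
have cP n : sval (c n) `<` sval (c n.+1) by exact: fP.
have [n|n|N Nst] := noethR (fun n => sval (c n)).
- by case: (c n) => ? [].
- exact: (cP n).1.
- by have [_] := cP N; rewrite (Nst N.+1) //; apply.
Qed.

(* The exact sequence 0 -> R / (I : a) -> R / I -> R / (I + (a)) -> 0 replaces
   the usual filtration of R with quotients R / P, P prime. *)
Lemma noetherian_prime_ind (Q : set R -> Prop) :
  Q setT -> (forall P, prime_ideal P -> Q P) ->
  (forall I a, ideal I -> Q (add_principal I a) -> Q (colon I a) -> Q I) ->
  forall I, ideal I -> Q I.
Proof.
move=> QT Qprime Qstep; apply: noetherian_ind => I idI IHI.
have [I1|nI1] := pselect (I 1); first by rewrite (ideal_eqT idI I1).
have [|nprI] := pselect (prime_ideal I); first exact: Qprime.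
have [x [y [Ixy nIx nIy]]] : exists x y, [/\ I (x * y), ~ I x & ~ I y].
  apply: contrapT => nxy; apply: nprI; apply/prime_idealP; split=> // x y Ixy.
  have [?|nIx] := pselect (I x); [by left|right].
  by apply: contrapT => nIy; apply: nxy; exists x, y.
apply: (Qstep I x idI); apply: IHI.
- exact: ideal_add_principal.
- split; first exact: sub_add_principal.
  by move=> /(_ x (add_principal_mem x idI)).
- exact: ideal_colon.
- by split; [exact: sub_colon|move=> /(_ y Ixy)].
Qed.

Lemma exists_maximal_above {I} : Defs.proper_ideal I ->
  exists2 M, maximal_ideal M & I `<=` M.
Proof.
move=> /proper_idealE[idI]; move: I idI; apply: noetherian_ind => I idI IHI nI1.
have [[J [idJ nJ1 IJ]]|nJ] := pselect (exists J, [/\ ideal J, ~ J 1 & I `<` J]).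
  have [M maxM JM] := IHI J idJ IJ nJ1; exists M => //.
  exact: subset_trans IJ.1 JM.
exists I => //; split; first exact/proper_idealE.
move=> J /proper_idealE[idJ nJ1] IJ; apply/seteqP; split=> //.
by apply: contrapT => JI; apply: nJ; exists J.
Qed.

Lemma exists_maximal_above_prime {P} : prime_ideal P ->
  exists2 M, maximal_ideal M & P `<=` M.
Proof. by move=> [properP _]; exact: exists_maximal_above. Qed.

(** A prime above [I] is above I + (a) if it contains [a], and above (I : a) otherwise, so the two
    finite families can be joined. *)
Lemma finite_primes_below I : ideal I -> exists F : set (set R),
  [/\ finite_set F, F `<=` @prime_ideal R &
      forall P, prime_ideal P -> I `<=` P -> exists2 Q, F Q & Q `<=` P].
Proof.
move: I; apply: noetherian_prime_ind.
- exists set0; split=> // P prP /(_ 1 Logic.I) P1.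
  by case: (prime_ideal1 prP).
- by move=> P prP; exists [set P]; split=> // [_ ->//|Q _ PQ]; exists P.
move=> I a idI [F [finF prF Fsub]] [G [finG prG Gsub]].
exists (F `|` G); split=> [|P [/prF|/prG]//|P prP IP].
  by rewrite finite_setU.
have idP := prime_ideal_ideal prP.
have [Pa|nPa] := pselect (P a).
  have [|Q FQ QP] := Fsub P prP; first exact: add_principal_sub.
  by exists Q => //; left.
have [|Q GQ QP] := Gsub P prP; last by exists Q => //; right.
by move=> x /IP /(prime_idealM prP)[].
Qed.

Lemma Spec_finite : finite_set (@prime_ideal R) ->
  finite_set [set: Spec R].
Proof.
move=> finP; rewrite (_ : setT = val @^-1` @prime_ideal R).
  by apply: finite_preimage finP => P Q _ _; exact: val_inj.
by apply/seteqP; split=> // P _; exact: Spec_prime.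
Qed.

(** [jacobson R] is a finite intersection of maximal ideals and, being nil, lies in [P]; so [P]
    contains one of these maximal ideals. *)
Lemma nil_fmax_primes_maximal :
  fmax_ring R -> nil_ideal (jacobson R) -> primes_maximal R.
Proof.
move=> fmaxR nilJ P prP.
have idP := prime_ideal_ideal prP.
have [||M maxM /(maximal_sub_prime maxM prP)->//] :=
  prime_bigcap_sub fmaxR _ prP.
  by move=> M /maximal_prime/prime_ideal_ideal.
move=> x /nilJ[n xn]; apply: (prime_idealX n prP).
by rewrite xn; exact: ideal0.
Qed.

Lemma pamin_primes_maximal : pamin_ring R -> primes_maximal R.
Proof.
move=> paminR P prP; have [M maxM PM] := exists_maximal_above_prime prP.
have [[_ /(_ P prP PM)->//]] := paminR M (maximal_prime maxM).
Qed.

Lemma pbmax_primes_maximal : pbmax_ring R -> primes_maximal R.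
Proof. by move=> pbmaxR P /pbmaxR[]. Qed.

Lemma krull_dim0_primes_maximal : krull_dim R = 0%:E -> primes_maximal R.
Proof.
move=> dimR P prP; have [M maxM PM] := exists_maximal_above_prime prP.
suff MP : M `<=` P by rewrite (_ : P = M) //; apply/seteqP.
apply: contrapT => nMP; move: dimR; rewrite /krull_dim.
set A := [set _ | _ in _] => dimR.
have A1 : A 1%:Z%:E.
  exists 1%N => //; exists (fun i => if i is 0%N then P else M).
  by split=> [[|i] _|[|i]] //; exact: maximal_prime.
(* [A] is nonempty, so the supremum comes from [xget] on the suprema of [A]; neither its default -oo
   nor an upper bound of the element 1 can be 0. *)
move: dimR; rewrite /supremum ifF; last first.
  by apply/eqP => A0; move: A1; rewrite A0.
by case: xgetP => // _ -> [/(_ _ A1)] /[swap] _ /[swap] ->.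
Qed.

(** * Noetherian rings in which every prime is maximal *)

Section PrimesMaximal.
Hypothesis primesR : primes_maximal R.

Lemma decreasing_sub {J : nat -> set R} : (forall n, J n.+1 `<=` J n) ->
  forall m n, (m <= n)%N -> J n `<=` J m.
Proof.
move=> decJ m n /subnKC <-; elim: (n - m)%N => [|k IHk]; first by rewrite addn0.
by rewrite addnS; exact: subset_trans (decJ _) IHk.
Qed.

Lemma primes_maximal_artinian : artinian R.
Proof.
(* Chains of ideals above [I] stand for chains in R / I, which puts the claim in the form that
   [noetherian_prime_ind] takes. *)
suff art I : ideal I -> forall J : nat -> set R, (forall n, ideal (J n)) ->
    (forall n, J n.+1 `<=` J n) -> (forall n, I `<=` J n) ->
    exists N, forall n, (N <= n)%N -> J n = J N.
  move=> J idJ decJ; apply: (art [set 0]) => //; first exact: ideal_set0.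
  by move=> n _ ->; exact: ideal0.
move: I; apply: noetherian_prime_ind.
- move=> J _ _ TJ; exists 0%N => n _.
  have JT m : J m = setT by apply/seteqP; split=> // x _; exact: TJ.
  by rewrite !JT.
- move=> P /primesR[_ Pmax] J idJ decJ PJ.
  (* Over the maximal ideal [P] each term is [P] or R: the chain drops to [P] for good or stays at
     R. *)
  have [[N nJN1]|J1] := pselect (exists N, ~ J N 1).
    have JP n : (N <= n)%N -> J n = P.
      move=> Nn; apply: Pmax (PJ n); apply/proper_idealE; split=> //.
      by move=> /(decreasing_sub decJ _ _ Nn).
    by exists N => n Nn; rewrite !JP.
  have JT n : J n = setT.
    by apply: ideal_eqT => //; apply: contrapT => nJn1; apply: J1; exists n.
  by exists 0%N => n _; rewrite !JT.
- move=> I a idI artD artC J idJ decJ IJ.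
  have [||n|N NstD] := artD (fun n => add_principal (J n) a).
  + by move=> n; exact: ideal_add_principal.
  + by move=> n x [r Jxr]; exists r; exact: decJ.
  + by move=> x [r Ixr]; exists r; exact: IJ.
  have [||n|M MstC] := artC (fun n => colon (J n) a).
  + by move=> n; exact: ideal_colon.
  + by move=> n x; exact: decJ.
  + by move=> x; exact: IJ.
  exists (maxn N M) => n; rewrite geq_max => /andP[Nn Mn].
  have decNM : J n `<=` J (maxn N M).
    by apply: decreasing_sub; rewrite // geq_max Nn.
  apply/seteqP; split=> // x Jx.
  (* Modulo [J n], [x] equals [r * a], which thus lies in the larger ideal [J (maxn N M)]. So [r] is
     in the colon of that ideal, which is the colon of [J n], and [r * a] is in [J n]. *)
  have [r Jnxr] : add_principal (J n) a x.
    rewrite NstD // -(NstD (maxn N M)) ?leq_maxl //.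
    exact: sub_add_principal.
  rewrite -(subrK (r * a) x); apply: idealD => //.
  rewrite mulrC; suff : colon (J n) a r by [].
  rewrite MstC // -(MstC (maxn N M)) ?leq_maxr // /colon /= mulrC.
  by rewrite -(subKr x (r * a)); apply: idealB => //; exact: decNM.
Qed.

(** Every prime lies above one of finitely many primes; these are maximal, so it equals one of
    them. *)
Lemma primes_maximal_finite : finite_set (@prime_ideal R).
Proof.
have [F [finF prF Fsub]] := finite_primes_below _ (@ideal_set0 R).
apply: sub_finite_set finF => P prP.
have [|Q FQ QP] := Fsub P prP.
  by move=> _ ->; exact: ideal0 (prime_ideal_ideal prP).
by rewrite (maximal_sub_prime (primesR _ (prF _ FQ)) prP QP).
Qed.

Lemma primes_maximal_fmax : fmax_ring R.
Proof.
by apply: sub_finite_set primes_maximal_finite => M; exact: maximal_prime.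
Qed.

Lemma primes_maximal_nilpotent : nilpotent_ideal (jacobson R).
Proof.
suff pow I : ideal I -> exists n, ideal_exp (jacobson R) n `<=` I.
  have [n Jn0] := pow _ (@ideal_set0 R); exists n; apply/seteqP; split=> //.
  by move=> _ ->; exact: ideal0 (ideal_ideal_exp _ _).
move: I; apply: noetherian_prime_ind.
- by exists 0%N.
- move=> P prP; have idP := prime_ideal_ideal prP.
  exists 1%N; apply: ideal_expS_sub => // x Jx y _.
  by rewrite /colon /= mulrC; apply: idealMl => //; apply: Jx; exact: primesR.
(* With J^m in I + (a) and J^n in (I : a), the product [x * y = (x - r * a) * y + r * (a * y)] is in
   [I]. *)
move=> I a idI [m Jm] [n Jn]; exists (m + n)%N.
apply: ideal_expD_sub => // x y /Jm[r Ixr] /Jn Iay.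
rewrite -(subrK (r * a) x) mulrDl -mulrA.
by apply: idealD; [|rewrite mulrC|]; try exact: idealMl.
Qed.

Lemma primes_maximal_barely {P} : prime_ideal P -> barely_maximal P.
Proof.
move=> prP; split=> [|capP]; first exact: primesR.
have [||Q [maxQ QP] QsubP] := prime_bigcap_sub _ _ prP capP.
- by apply: sub_finite_set primes_maximal_fmax => Q [].
- by move=> Q [/maximal_prime/prime_ideal_ideal].
by apply: QP; rewrite /= (maximal_sub_prime maxQ prP QsubP).
Qed.

Lemma primes_maximal_prime : @maximal_ideal R = @prime_ideal R.
Proof. by apply/seteqP; split=> P; [exact: maximal_prime|exact: primesR]. Qed.

Lemma primes_maximal_minimal : @minimal_prime R = @prime_ideal R.
Proof.
apply/seteqP; split=> P; first by case.
move=> prP; split=> // Q prQ QP.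
by rewrite (maximal_sub_prime (primesR _ prQ) prP QP).
Qed.

Lemma primes_maximal_pamin : pamin_ring R.
Proof.
move=> P prP; rewrite /absolutely_minimal primes_maximal_minimal.
by split=> //; rewrite -primes_maximal_prime; case: (primes_maximal_barely prP).
Qed.

Lemma primes_maximal_krull_dim : krull_dim R = 0%:E.
Proof.
have [M maxM] := @exists_maximal_ideal R.
rewrite /krull_dim (_ : [set _ | _ in _] = [set 0%:Z%:E]).
  exact: supremum1.
apply/seteqP; split=> [_ [[|n] [C [prC ltC]] <-]//|_ ->]; last first.
  by exists 0%N => //; exists (fun=> M); split=> // i _; exact: maximal_prime.
(* A chain of positive length would begin with a prime strictly above the maximal ideal [C 0]. *)
have [C01] := ltC 0%N isT; case.
by rewrite (maximal_sub_prime (primesR _ (prC 0%N isT)) (prC 1%N isT) C01).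
Qed.

(** The closure of the point [Q] is the set of primes containing [Q], which is [Q] alone when [Q] is
    maximal. *)
Lemma primes_maximal_accessible : accessible_space (Spec R).
Proof.
move=> P Q PQ; exists (~` zero_locus (val Q)); split.
- by rewrite open_SpecE; exists (val Q).
- apply/mem_set => QP; case/eqP: PQ; apply: val_inj.
  exact: maximal_sub_prime (primesR _ (Spec_prime Q)) (Spec_prime P) QP.
- by apply/mem_set; apply.
Qed.

(** Every subset of a finite T1 space is finite, hence closed. *)
Lemma primes_maximal_discrete : discrete_space (Spec R).
Proof.
move=> A; rewrite -(setCK A); apply: closed_openC.
apply: (accessible_finite_set_closed.1 primes_maximal_accessible).
by apply: sub_finite_set (Spec_finite primes_maximal_finite).
Qed.

End PrimesMaximal.

(** * Separation axioms on the spectrum *)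

Lemma open_basic (x : R) : open (~` zero_locus [set x] : set (Spec R)).
Proof. by rewrite open_SpecE; exists [set x]. Qed.

(* Open sets of Spec R are stable under generization. *)
Lemma separated_primes_maximal :
  (forall P Q : Spec R, distinguishable P Q ->
     exists2 U : set (Spec R), open U & U Q /\ ~ U P) ->
  primes_maximal R.
Proof.
move=> sep P prP; have [M maxM PM] := exists_maximal_above_prime prP.
suff MP : M `<=` P by rewrite (_ : P = M) //; apply/seteqP.
move=> x Mx; apply: contrapT => nPx.
pose p : Spec R := SigSub (mem_set prP : P \in [set P | prime_ideal P]).
pose m : Spec R :=
  SigSub (mem_set (maximal_prime maxM) : M \in [set P | prime_ideal P]).
(* The basic open set of [x] contains [p] but not [m]; [sep] turns this around into an open set with
   [m] but without [p], against generization. *)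
have [|U] := sep p m.
  exists (~` zero_locus [set x]); split; first exact: open_basic.
  by left; split=> [/(_ x erefl)//|]; apply=> _ ->.
rewrite open_SpecE => -[E _ <-] [nEM nEP]; apply: nEM => y Ey.
apply: PM; apply: contrapT => nPy.
by apply: nEP => /(_ y Ey).
Qed.

Lemma distinguishable_neq {T : topologicalType} (x y : T) :
  distinguishable x y -> x != y.
Proof.
by move=> [U [_ Uxy]]; apply/eqP => xy; case: Uxy; rewrite xy => -[].
Qed.

Lemma accessible_R0 {T : topologicalType} : accessible_space T -> R0_space T.
Proof.
move=> accT x y /distinguishable_neq xy.
have [U [oU /set_mem Ux /set_mem nUy]] := accT x y xy.
rewrite eq_sym in xy; have [V [oV /set_mem Vy /set_mem nVx]] := accT y x xy.
by exists U, V.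
Qed.

Lemma R1_R0 {T : topologicalType} : R1_space T -> R0_space T.
Proof.
move=> R1T x y /R1T[U [V [[oU Ux] [oV Vy] UV]]]; exists U, V.
by split=> // [Uy|Vx]; [rewrite -[False]/(set0 y)|rewrite -[False]/(set0 x)];
  rewrite -UV.
Qed.

Lemma hausdorff_R1 {T : topologicalType} : hausdorff_space T -> R1_space T.
Proof.
rewrite open_hausdorff => hT x y /distinguishable_neq/hT[[U V] /= [Ux Vy]].
by move=> [oU oV /eqP UV]; exists U, V; split=> //; split=> //; exact: set_mem.
Qed.

Lemma discrete_hausdorff {T : topologicalType} :
  discrete_space T -> hausdorff_space T.
Proof.
move=> dT; rewrite open_hausdorff => x y xy; exists ([set x], [set y]).
  by split; exact/mem_set.
split; [exact: dT|exact: dT|apply/eqP/seteqP; split=> // z [/= -> yx]].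
by rewrite yx eqxx in xy.
Qed.

Lemma R0_primes_maximal : R0_space (Spec R) -> primes_maximal R.
Proof.
move=> R0; apply: separated_primes_maximal => P Q /R0.
by move=> [U [V [_ [oV VQ] _ nVP]]]; exists V.
Qed.

End Noetherian.

(** * Semisimple rings *)

Section Semisimple.
Context {S : comNzRingType}.

(* A simple ideal T not inside the prime P satisfies T `&` P = 0, so P
   annihilates T; a generator t of T is then inverted along any x outside of P:
   t = r * x * t gives (1 - r * x) * t = 0. *)
Lemma semisimple_primes_maximal : semisimple_ring S -> primes_maximal S.
Proof.
move=> [F [simpleF genF _]]; apply: primes_maximalP => P x prP nPx.
have idP := prime_ideal_ideal prP.
have [T FT nTP] : exists2 T, F T & ~ T `<=` P.
  apply: contrapT => nT; apply: (prime_ideal1 prP).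
  have : [set: S] 1 by []; rewrite -genF; apply; split=> // y [T FT Ty].
  by apply: contrapT => nPy; apply: nT; exists T => // /(_ y Ty).
have [idT T0 minT] := simpleF T FT.
have [t [Tt nPt]] : exists t, T t /\ ~ P t.
  apply: contrapT => nt; apply: nTP => t Tt.
  by apply: contrapT => nPt; apply: nt; exists t.
have [|||xtT] := minT (add_principal [set 0] (x * t)).
- exact: ideal_add_principal (@ideal_set0 S).
- apply: add_principal_sub => //; last exact: idealMl.
  by move=> _ ->; exact: ideal0.
- move=> xt0; have := add_principal_mem (x * t) (@ideal_set0 S).
  rewrite xt0 => xt; have /(prime_idealM prP)[]// : P (x * t).
  by rewrite xt; exact: ideal0.
have [r /= tr] : add_principal [set 0] (x * t) t by rewrite xtT.
exists r; have /(prime_idealM prP)[]// : P ((1 - r * x) * t).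
by rewrite mulrBl mul1r -mulrA tr; exact: ideal0.
Qed.

(* The simple summands are the intersections of all maximal ideals but one. *)
Lemma pbmax_semisimple : pbmax_ring S ->
  (forall I : set S, Defs.proper_ideal I ->
     exists2 M, maximal_ideal M & I `<=` M) ->
  jacobson S = [set 0] -> semisimple_ring S.
Proof.
move=> pbmaxS above J0.
pose C (M : set S) := \bigcap_(N in @maximal_ideal S `\ M) N.
have idM (M : set S) : maximal_ideal M -> ideal M.
  by move=> /maximal_prime/prime_ideal_ideal.
have idC M : ideal (C M) by apply: ideal_bigcap => N [/idM].
have CM0 M x : maximal_ideal M -> C M x -> M x -> x = 0.
  move=> maxM CMx Mx; suff : jacobson S x by rewrite J0.
  move=> N maxN; have [->//|NM] := pselect (N = M).
  exact: CMx.
have nCM M : maximal_ideal M -> exists2 x, C M x & ~ M x.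
  move=> /maximal_prime/pbmaxS[_ nsub]; apply: contrapT => nx; apply: nsub.
  by move=> x Cx; apply: contrapT => nMx; apply: nx; exists x.
exists [set C M | M in @maximal_ideal S]; split.
- move=> _ [M maxM <-]; have [x Cx nMx] := nCM M maxM; split=> //.
    move=> C0; apply: nMx; move: Cx; rewrite C0 => ->.
    exact: ideal0 (idM _ maxM).
  move=> I idI IC; have [IM|nIM] := pselect (I `<=` M).
    left; apply/seteqP; split=> [y Iy|_ ->]; last exact: ideal0.
    exact: CM0 (IC _ Iy) (IM _ Iy).
  right; apply/seteqP; split=> // s Cs.
  have [i Ii nMi] : exists2 i, I i & ~ M i.
    apply: contrapT => ni; apply: nIM => i Ii.
    by apply: contrapT => nMi; apply: ni; exists i.
  have [_ _ /(_ i nMi)[r Mri]] := (maximal_idealP M).1 maxM.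
  (* [(1 - r * i) * s] lies in both [M] and [C M], hence vanishes, so [s = r * i * s] is in [I]. *)
  suff /eqP : (1 - r * i) * s = 0.
    rewrite mulrBl mul1r subr_eq0 => /eqP->.
    by rewrite mulrAC; exact: idealMl.
  apply: (CM0 M) => //; first exact: (idealMl _ (idC M)).
  by rewrite mulrC; exact: (idealMl s (idM _ maxM)).
- apply: ideal_eqT; first exact: ideal_ideal_generated.
  apply: contrapT => n1.
  (* A maximal ideal [N] containing the whole sum would contain [C N], but [N] is barely maximal. *)
  have [|N maxN genN] := above (ideal_generated (\bigcup_(T in
    [set C M | M in @maximal_ideal S]) T)).
    by apply/proper_idealE; split=> //; exact: ideal_ideal_generated.
  have [x Cx] := nCM N maxN; apply; apply: genN.
  by apply: sub_ideal_generated; exists (C N) => //; exists N.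
move=> _ [M maxM <-]; apply/seteqP; split=> [x [Cx]|_ ->]; last first.
  by split; [exact: ideal0 (idC M)|exact: ideal0 (ideal_ideal_generated _)].
(* [M] is one of the ideals intersected in every other [C N], so the remaining summands all lie in
   [M]. *)
have subM : \bigcup_(T in [set C N | N in @maximal_ideal S] `\ C M) T `<=` M.
  move=> y [_ [[N maxN <-] NM] CNy]; apply: CNy; split=> // MN.
  by apply: NM; rewrite MN.
by move=> /(ideal_generated_sub (idM _ maxM) subM); exact: CM0.
Qed.

End Semisimple.

(** * Ideals and primes along a surjective ring morphism *)

Section Surjection.
Context {R S : comNzRingType} (f : {rmorphism R -> S}).
Hypothesis surj_f : forall y, exists x, f x = y.

Lemma ideal_preimage (I : set S) : ideal I -> ideal (f @^-1` I).
Proof.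
move=> idI; apply/idealE; split; first by rewrite /= rmorph0; exact: ideal0.
move=> a x y Ix Iy; rewrite /= rmorphD rmorphM.
by apply: idealD => //; exact: idealMl.
Qed.

Lemma prime_preimage (P : set S) : prime_ideal P -> prime_ideal (f @^-1` P).
Proof.
move=> prP; apply/prime_idealP; split.
- exact: ideal_preimage (prime_ideal_ideal prP).
- by rewrite /= rmorph1; exact: prime_ideal1.
- by move=> x y; rewrite /= rmorphM; exact: prime_idealM.
Qed.

Lemma preimage_surj_inj (A B : set S) : f @^-1` A = f @^-1` B -> A = B.
Proof.
move=> AB; apply/seteqP; split=> y; have [x <-] := surj_f y => Ax.
  by have : (f @^-1` A) x by []; rewrite AB.
by have : (f @^-1` B) x by []; rewrite -AB.
Qed.

Lemma noetherian_surj : noetherian R -> noetherian S.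
Proof.
move=> noethR I idI incI.
have [n|n x|N Nst] := noethR (fun n => f @^-1` I n).
- exact: ideal_preimage.
- exact: incI.
- by exists N => n Nn; apply: preimage_surj_inj; exact: Nst.
Qed.

Lemma primes_maximal_surj : primes_maximal R -> primes_maximal S.
Proof.
move=> primesR; apply: primes_maximalP => P y prP nPy.
have [x fx] := surj_f y.
have /maximal_idealP[_ _ /(_ x)[]] := primesR _ (prime_preimage _ prP).
  by rewrite /= fx.
move=> r; rewrite /= rmorphB rmorphM rmorph1 fx => Pr.
by exists (f r).
Qed.

Lemma image_ideal_mem {I : set R} {x} : ideal I -> (forall z, f z = 0 -> I z) ->
  (f @` I) (f x) <-> I x.
Proof.
move=> idI kerI; split=> [[y Iy fyx]|Ix]; last by exists x.
rewrite -(subrK y x); apply: idealD => //; apply: kerI.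
by rewrite rmorphB fyx subrr.
Qed.

Lemma prime_image (P : set R) : prime_ideal P -> (forall z, f z = 0 -> P z) ->
  prime_ideal (f @` P).
Proof.
move=> prP kerP; have idP := prime_ideal_ideal prP.
have memP x := image_ideal_mem (x := x) idP kerP.
apply/prime_idealP; split.
- apply/idealE; split; first by rewrite -(rmorph0 f); apply/memP; exact: ideal0.
  move=> a _ _ [x Px <-] [y Py <-]; have [b <-] := surj_f a.
  by rewrite -rmorphM -rmorphD; apply/memP; apply: idealD => //; exact: idealMl.
- by rewrite -(rmorph1 f) => /memP; exact: prime_ideal1.
move=> u v; have [x <-] := surj_f u; have [y <-] := surj_f v.
rewrite -rmorphM => /memP/(prime_idealM prP)[Px|Py]; [left|right]; exact/memP.
Qed.

End Surjection.

(** * The quotient by the Jacobson radical *)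

Section ModJacobson.
Context {R : comNzRingType} (noethR : noetherian R).
Let S := {ideal_quot jacobson_pred R}.
Let proj : {rmorphism R -> S} := \pi_S%qT.

Lemma proj_surj (y : S) : exists x, proj x = y.
Proof. by exists (repr y); rewrite /proj /= reprK. Qed.

Lemma proj_eq0 x : proj x = 0 <-> jacobson R x.
Proof.
rewrite /proj /= -(rmorph0 proj); split=> [/eqP|Jx]; last apply/eqP.
  by rewrite -Quotient.idealrBE subr0 => /set_mem.
by rewrite -Quotient.idealrBE subr0; exact: mem_set.
Qed.

(** A nil radical lies in every prime [P], so the image of [P] in R / J(R) is prime, hence maximal;
    an inverse of [x] modulo that image lifts to R. *)
Lemma semilocal_primes_maximal :
  semilocal R -> nilpotent_ideal (jacobson R) -> primes_maximal R.
Proof.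
move=> /semisimple_primes_maximal primesS /nilpotent_nil nilJ.
apply: primes_maximalP => P x prP nPx; have idP := prime_ideal_ideal prP.
have kerP z : proj z = 0 -> P z.
  move=> /proj_eq0/nilJ[n zn]; apply: (prime_idealX n prP).
  by rewrite zn; exact: ideal0.
have memP z := image_ideal_mem proj (x := z) idP kerP.
have /maximal_idealP[_ _ /(_ (proj x))[]] :=
  primesS _ (prime_image _ proj_surj _ prP kerP).
  by move=> /memP.
move=> s; have [r <-] := proj_surj s.
by rewrite -(rmorph1 proj) -rmorphM -rmorphB => /memP; exists r.
Qed.

Lemma primes_maximal_semilocal : primes_maximal R -> semilocal R.
Proof.
move=> primesR; have noethS := noetherian_surj _ proj_surj noethR.
have primesS := primes_maximal_surj _ proj_surj primesR.
apply: pbmax_semisimple.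
- by move=> P; exact: primes_maximal_barely.
- by move=> I; exact: exists_maximal_above.
apply/seteqP; split=> [y|_ -> M /maximal_prime/prime_ideal_ideal]; last first.
  exact: ideal0.
(* A maximal ideal [M] of R contains J(R), so its image is prime, hence maximal in the quotient, and
   contains the class of [x]. *)
have [x <-] := proj_surj y => Jx; apply/proj_eq0 => M maxM.
have prM := maximal_prime maxM.
have kerM z : proj z = 0 -> M z by move=> /proj_eq0; apply.
apply/(image_ideal_mem proj (prime_ideal_ideal prM) kerM).
by apply: Jx; apply: primesS; exact: (prime_image _ proj_surj).
Qed.

End ModJacobson.

Theorem theorem2p36 (R : comNzRingType) (noethR : noetherian R) :
  [<-> artinian R;
       semilocal R /\ nilpotent_ideal (jacobson R);
       fmax_ring R /\ nilpotent_ideal (jacobson R);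
       fmax_ring R /\ nil_ideal (jacobson R);
       krull_dim R = 0%:E;
       finite_set [set: Spec R] /\ accessible_space (Spec R);
       finite_set [set: Spec R] /\ R0_space (Spec R);
       finite_set [set: Spec R] /\ R1_space (Spec R);
       finite_set [set: Spec R] /\ hausdorff_space (Spec R);
       discrete_space (Spec R);
       discrete_space (Spec R) /\ finite_set [set: Spec R];
       pamin_ring R;
       pbmax_ring R;
       pi_regular R].
Proof.
have finSpec (primesR : primes_maximal R) : finite_set [set: Spec R].
  exact: Spec_finite (primes_maximal_finite noethR primesR).
have hausSpec (primesR : primes_maximal R) : hausdorff_space (Spec R).
  exact: discrete_hausdorff (primes_maximal_discrete noethR primesR).
have R0max := R0_primes_maximal noethR.
(* The conditions form a cycle in the order listed, closed by the arrow from pi-regular to Artinian;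
   most arrows pass through [primes_maximal R]. *)
tfae.
- move=> /artinian_pi_regular/pi_regular_primes_maximal primesR; split.
    exact: primes_maximal_semilocal.
  exact: primes_maximal_nilpotent.
- move=> [sl nil]; split=> //; apply: primes_maximal_fmax => //.
  exact: semilocal_primes_maximal.
- by move=> [? /nilpotent_nil].
- move=> [? ?]; apply: primes_maximal_krull_dim.
  exact: nil_fmax_primes_maximal.
- move=> /(krull_dim0_primes_maximal noethR) primesR; split.
    exact: finSpec.
  exact: primes_maximal_accessible.
- by move=> [? /accessible_R0].
- by move=> [fin /R0max/hausSpec/hausdorff_R1].
- by move=> [fin /R1_R0/R0max/hausSpec].
- move=> [_ /hausdorff_R1/R1_R0/R0max primesR].
  exact: primes_maximal_discrete.
- move=> dS; split=> //; apply: finSpec; apply: R0max.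
  exact: R1_R0 (hausdorff_R1 (discrete_hausdorff dS)).
- move=> [dS _]; apply: primes_maximal_pamin => //; apply: R0max.
  exact: R1_R0 (hausdorff_R1 (discrete_hausdorff dS)).
- move=> /(pamin_primes_maximal noethR) primesR P.
  exact: primes_maximal_barely.
- move=> /pbmax_primes_maximal primesR; apply: artinian_pi_regular.
  exact: primes_maximal_artinian.
- move=> /pi_regular_primes_maximal primesR.
  exact: primes_maximal_artinian.
Qed.
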